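(* Let $P^n$ be a simple polytope with facets $F_1,\dots,F_m$, let $\lambda$ be a characteristic function on $P^n$, and let $X_1,\dots,X_m$ be spaces each equipped with a free action of $S^1$. Then the diagram $$\begin{array}{ccc} (X_1\times\cdots\times X_m\times P^n)/\!\sim_1 & \xrightarrow{\ \beta\ } & \big((X_1\times\cdots\times X_m)/\ker\lambda\big)\times P^n/\!\sim_2\\ {\scriptstyle\alpha}\downarrow{\scriptstyle\cong} & & {\scriptstyle\gamma}\downarrow{\scriptstyle\cong}\\ Z\big(K_P;(\underline{CX},\underline{X})\big) & \xrightarrow{\ \delta\ } & Z\big(K_P;(\underline{CX},\underline{X})\big)/\ker\lambda \end{array}$$ commutes and the vertical maps $\alpha$ and $\gamma$ are homeomorphisms. Here $\alpha$ is the map determined by a cubical structure on $P^n$; $\delta$ is the orbit map; $\beta$ is the composite of the orbit map $$(X_1\times\cdots\times X_m\times P^n)/\!\sim_1\ \longrightarrow\ \big((X_1\times\cdots\times X_m\times P^n)/\!\sim_1\big)/\ker\lambda$$ with $h^{-1}$; and $\gamma=\overline{\alpha}\circ h$, where $\overline{\alpha}$ is the map of $\ker\lambda$-orbit spaces induced by $\alpha$ (all objects are defined in the context).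
   Context: A polytope $P^n$ of dimension $n$ is simple if exactly $n$ facets meet at each vertex. $K_P$ is the simplicial complex dual to the boundary of $P^n$: its vertices $1,\dots,m$ correspond to the facets, and a set of vertices is a simplex iff the corresponding facets have non-empty intersection. A characteristic function is a map $\lambda:\{F_1,\dots,F_m\}\to\mathbb{Z}^n$ such that whenever $F_{i_1}\cap\cdots\cap F_{i_l}$ is a codimension-$l$ face, $\lambda(F_{i_1}),\dots,\lambda(F_{i_l})$ span a rank-$l$ submodule of $\mathbb{Z}^n$ that is a direct summand. It is regarded as an $n\times m$ integer matrix $\mathbb{Z}^m\to\mathbb{Z}^n$, hence as a homomorphism of tori $T^m\to T^n$; $\ker\lambda\subset T^m$ denotes its kernel, isomorphic to $T^{m-n}$. The circles of $T^m$ are indexed by the facets. $T^m$ acts on $X_1\times\cdots\times X_m$ coordinatewise. For distinct indices $i_1,\dots,i_{m-k}$, $T^m$ (hence $\ker\lambda$) acts on $X_{i_1}\times\cdots\times X_{i_{m-k}}$ through the coordinate projection $T^m\to T^{m-k}$, and there is an induced projection $\pi_{i_1,\dots,i_{m-k}}:(X_1\times\cdots\times X_m)/\ker\lambda\to (X_{i_1}\times\cdots\times X_{i_{m-k}})/\ker\lambda$. Write $[x_1,\dots,x_m]_\lambda$ for the $\ker\lambda$-orbit of $(x_1,\dots,x_m)$. For $p\in P^n$ let $F(p)=F_{j_1}\cap\cdots\cap F_{j_k}$ be the unique face with $p$ in its relative interior ($F_{j_1},\dots,F_{j_k}$ being all the facets containing $p$), and let $\{F_{i_1},\dots,F_{i_{m-k}}\}$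 be the complementary set of facets. Relation $\sim_1$ on $X_1\times\cdots\times X_m\times P^n$: $(x_1,\dots,x_m,p)\sim_1(y_1,\dots,y_m,q)$ iff $p=q$ and $x_{i_s}=y_{i_s}$ for all $s=1,\dots,m-k$. Classes are denoted $[(x_1,\dots,x_m,p)]_1$. The group $\ker\lambda$ acts on the quotient by $t\cdot[(x_1,\dots,x_m,p)]_1=[(t\cdot(x_1,\dots,x_m),p)]_1$. Relation $\sim_2$ on $\big((X_1\times\cdots\times X_m)/\ker\lambda\big)\times P^n$: $([x_1,\dots,x_m]_\lambda,p)\sim_2([y_1,\dots,y_m]_\lambda,q)$ iff $p=q$ and $\pi_{i_1,\dots,i_{m-k}}([x_1,\dots,x_m]_\lambda)=\pi_{i_1,\dots,i_{m-k}}([y_1,\dots,y_m]_\lambda)$. Classes are denoted $[([x_1,\dots,x_m]_\lambda,p)]_2$. $h$ is the homeomorphism $\big((X_1\times\cdots\times X_m)/\ker\lambda\big)\times P^n/\!\sim_2\ \to\ \big((X_1\times\cdots\times X_m\times P^n)/\!\sim_1\big)/\ker\lambda$ given by $h([([x_1,\dots,x_m]_\lambda,p)]_2)=$ the $\ker\lambda$-orbit of $[(x_1,\dots,x_m,p)]_1$. Cones and polyhedral product: $CX_i=X_i\times I/(X_i\times\{0\})$ with $I=[0,1]$ and $X_i=X_i\times\{1\}\subset CX_i$. $Z(K_P;(\underline{CX},\underline{X}))=\bigcup_{\sigma\in K_P}\prod_{i=1}^m B_i(\sigma)\subseteq CX_1\times\cdots\times CX_m$, where $B_i(\sigma)=CX_i$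 if $i\in\sigma$ and $B_i(\sigma)=X_i$ if $i\notin\sigma$. The $S^1$-action on $X_i$ extends to $CX_i$ preserving the cone parameter, so $T^m$, and hence $\ker\lambda$, acts on $Z(K_P;(\underline{CX},\underline{X}))$. Cubical structure and $\alpha$: $P^n$ has a standard cubical structure with one $n$-cube for each vertex, given by an embedding $c=(c_1,\dots,c_m):P^n\to I^m$ with image $\bigcup_{\sigma\in K_P}\{u\in I^m: u_i=1\text{ for }i\notin\sigma\}$ and with $c_i(p)=0$ iff $p\in F_i$. The map $\alpha$ is $\alpha([(x_1,\dots,x_m,p)]_1)=([x_1,c_1(p)],\dots,[x_m,c_m(p)])$. It is equivariant for the actions of $\ker\lambda$, so it induces $\overline{\alpha}:\big((X_1\times\cdots\times X_m\times P^n)/\!\sim_1\big)/\ker\lambda\to Z(K_P;(\underline{CX},\underline{X}))/\ker\lambda$.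
   Formalization: All products of spaces (of the X_i, with I, with P, and of the cones) carry the compactly generated topology; with the ordinary product topology α need not be a homeomorphism, e.g. for P=[0,1], X_1=S^1×ℕ, X_2=S^1×ℚ. *)

(* Defs.v *)
From HB Require Import structures.
From mathcomp Require Import all_boot all_order all_algebra.
From mathcomp Require Import all_classical all_reals all_analysis.
From mathcomp Require Import complex.

Set Implicit Arguments.
Unset Strict Implicit.
Unset Printing Implicit Defensive.

Import Order.TTheory GRing.Theory Num.Theory.
Import numFieldNormedType.Exports.

Local Open Scope classical_set_scope.
Local Open Scope ring_scope.
Local Open Scope quotient_scope.

(** "Space" is read as in the category of compactly generated spaces: every
  product of spaces carries the k-ification of the product topology (tested on
  maps from compact Hausdorff spaces).  With the plain product topology, a
  product of quotient maps, such as X * I -> CX times an identity, need not be a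
  quotient map, and for general X_i the space (X_1 * ... * X_m * P)/~1 is not
  homeomorphic to the polyhedral product by the natural map.  For compact
  Hausdorff X_i, k-ification changes no product that occurs here. *)

Definition kopen (T : topologicalType) (U : set T) : Prop :=
  forall (K : topologicalType) (f : K -> T),
    compact [set: K] -> hausdorff_space K -> continuous f -> open (f @^-1` U).

Definition kify (T : topologicalType) : Type := T.

Section KIfication.
Variable T : topologicalType.

HB.instance Definition _ := Choice.on (kify T).

Let kopenT : @kopen T [set: T].
Proof. by move=> K f _ _ _; rewrite preimage_setT; exact: openT. Qed.

Let kopenI (A B : set T) : kopen A -> kopen B -> kopen (A `&` B).
Proof.
by move=> kA kB K f cK hK cf; rewrite preimage_setI; apply: openI;
  [exact: kA | exact: kB].
Qed.

Let kopen_bigU (I : Type) (f : I -> set T) :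
  (forall i, kopen (f i)) -> kopen (\bigcup_i f i).
Proof.
move=> kf K g cK hK cg; rewrite preimage_bigcup.
by apply: bigcup_open => i _; exact: kf.
Qed.

HB.instance Definition _ :=
  isOpenTopological.Build (kify T) kopenT kopenI kopen_bigU.

End KIfication.

Definition kprod (I : Type) (Y : I -> topologicalType) : topologicalType :=
  kify (prod_topology Y).

Definition kprod2 (A B : topologicalType) : topologicalType :=
  kify (A * B)%type.

Definition homeomorphism (A B : topologicalType) (f : A -> B) : Prop :=
  exists g : B -> A,
    [/\ continuous f, continuous g, cancel f g & cancel g f].

Definition embedding (A B : topologicalType) (f : A -> B) : Prop :=
  injective f /\
  forall U : set A, open U <-> exists2 V : set B, open V & U = f @^-1` V.

Definition equiv_rel_of (T : choiceType) (r : T -> T -> Prop)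
    (r_refl : forall x, r x x) (r_sym : forall x y, r x y -> r y x)
    (r_trans : forall x y z, r x y -> r y z -> r x z) : equiv_rel T.
Proof.
apply: (EquivRel (fun x y => `[< r x y >]) _ _ _).
- by move=> x; exact/asboolP.
- by move=> x y; apply/asboolP/asboolP; exact: r_sym.
- by move=> y x z /asboolP xy /asboolP yz; apply/asboolP; exact: r_trans xy yz.
Defined.

Lemma equiv_rel_ofP (T : choiceType) (r : T -> T -> Prop) r_refl r_sym r_trans
    (x y : T) :
  reflect (r x y) (@equiv_rel_of T r r_refl r_sym r_trans x y).
Proof. exact: asboolP. Qed.

Definition quotient_space (T : topologicalType) (e : equiv_rel T) :
  topologicalType := quotient_topology {eq_quot e}.

Definition qclass (T : topologicalType) (e : equiv_rel T) (x : T) :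
  quotient_space e := \pi_{eq_quot e} x.

Definition rep (T : topologicalType) (e : equiv_rel T) (q : quotient_space e) :
  T := repr (q : {eq_quot e}).

Lemma repK (T : topologicalType) (e : equiv_rel T) :
  cancel (@rep T e) (@qclass T e).
Proof. exact: reprK. Qed.

Lemma qclassP (T : topologicalType) (e : equiv_rel T) (x y : T) :
  qclass e x = qclass e y <-> e x y.
Proof. by split=> [/eqmodP|/eqmodP]. Qed.

Lemma rep_class (T : topologicalType) (e : equiv_rel T) (x : T) :
  e x (rep (qclass e x)).
Proof. by apply/qclassP; rewrite repK. Qed.

Definition circle (R : realType) : Type :=
  set_type [set z : R[i]^o | `|z| = 1].

Section Circle.
Variable R : realType.
Local Notation circle := (circle R).

HB.instance Definition _ := Topological.on circle.

Lemma circle_norm (z : circle) : `|\val z : R[i]| = 1.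
Proof. by have /set_mem := valP z. Qed.

Definition to_circle (z : R[i]) (z1 : `|z| = 1) : circle :=
  exist _ (z : R[i]^o) (mem_set z1).

Fact circle1_subproof : `|1 : R[i]| = 1.
Proof. exact: normr1. Qed.

Fact circleM_subproof (z w : circle) : `|(\val z : R[i]) * \val w| = 1.
Proof. by rewrite normrM !circle_norm mulr1. Qed.

Fact circleV_subproof (z : circle) : `|(\val z : R[i])^-1| = 1.
Proof. by rewrite normfV circle_norm invr1. Qed.

Definition circle1 := to_circle circle1_subproof.
Definition circleM z w := to_circle (circleM_subproof z w).
Definition circleV z := to_circle (circleV_subproof z).

Fact circle_neq0 (z : circle) : (\val z : R[i]) != 0.
Proof. by rewrite -normr_eq0 circle_norm oner_eq0. Qed.

Fact circleMA : associative circleM.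
Proof. by move=> x y z; apply/val_inj; rewrite /= mulrA. Qed.
Fact circle1M : left_id circle1 circleM.
Proof. by move=> x; apply/val_inj; rewrite /= mul1r. Qed.
Fact circleM1 : right_id circle1 circleM.
Proof. by move=> x; apply/val_inj; rewrite /= mulr1. Qed.
Fact circleVM : left_inverse circle1 circleV circleM.
Proof. by move=> x; apply/val_inj; rewrite /= mulVf ?circle_neq0. Qed.
Fact circleMV : right_inverse circle1 circleV circleM.
Proof. by move=> x; apply/val_inj; rewrite /= mulfV ?circle_neq0. Qed.

HB.instance Definition _ :=
  isGroup.Build circle circleMA circle1M circleM1 circleVM circleMV.

End Circle.

Definition torus (R : realType) (m : nat) : Type := 'I_m -> circle R.

Section Torus.
Variables (R : realType) (m : nat).
Local Notation torus := (torus R m).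
Local Open Scope group_scope.

HB.instance Definition _ := Choice.on torus.

Let tM (s t : torus) : torus := fun i => s i * t i.
Let t1 : torus := fun=> 1.
Let tV (t : torus) : torus := fun i => (t i)^-1.
Let tMA : associative tM.
Proof. by move=> r s t; apply/funext => i; exact: mulgA. Qed.
Let t1M : left_id t1 tM.
Proof. by move=> t; apply/funext => i; exact: mul1g. Qed.
Let tM1 : right_id t1 tM.
Proof. by move=> t; apply/funext => i; exact: mulg1. Qed.
Let tVM : left_inverse t1 tV tM.
Proof. by move=> t; apply/funext => i; exact: mulVg. Qed.
Let tMV : right_inverse t1 tV tM.
Proof. by move=> t; apply/funext => i; exact: mulgV. Qed.

HB.instance Definition _ := isGroup.Build torus tMA t1M tM1 tVM tMV.

End Torus.

Section TorusHom.
Variables (R : realType) (n m : nat) (lam : 'M[int]_(n, m)).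

Fact torus_map_subproof (t : torus R m) (i : 'I_n) :
  `|\prod_(j < m) (\val (t j) : R[i]) ^ lam i j| = 1.
Proof.
rewrite normr_prod big1 // => j _.
by case: (lam i j) => k;
  rewrite ?NegzE -?exprnN -?exprnP ?normfV normrX circle_norm expr1n ?invr1.
Qed.

Definition torus_map (t : torus R m) : torus R n :=
  fun i => to_circle (torus_map_subproof t i).

Definition torus_ker : set (torus R m) := [set t | torus_map t = 1%g].

Lemma torus_kerE (t : torus R m) :
  torus_ker t <->
  forall i, \prod_(j < m) (\val (t j) : R[i]) ^ lam i j = 1.
Proof.
split=> [tk i|tk].
  by have := congr1 (fun s : torus R n => \val (s i) : R[i]) tk.
by apply/funext => i; apply/val_inj; exact: tk.
Qed.

Lemma torus_ker1 : torus_ker 1%g.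
Proof. by apply/torus_kerE => i; rewrite big1 // => j _; rewrite exp1rz. Qed.

Lemma torus_kerM s t : torus_ker s -> torus_ker t -> torus_ker (s * t)%g.
Proof.
move=> /torus_kerE sk /torus_kerE tk; apply/torus_kerE => i.
apply: etrans (etrans (congr2 *%R (sk i) (tk i)) (mulr1 _)).
rewrite -big_split /=.
by apply: eq_bigr => j _; rewrite -expfzMl.
Qed.

Lemma torus_kerV t : torus_ker t -> torus_ker t^-1%g.
Proof.
move=> /torus_kerE tk; apply/torus_kerE => i.
apply: etrans (etrans (congr1 GRing.inv (tk i)) (invr1 _)).
by rewrite -prodfV; apply: eq_bigr => j _; rewrite exprz_inv -invr_expz.
Qed.

End TorusHom.

Record circle_action (R : realType) (X : topologicalType) := CircleAction {
  cact :> circle R -> X -> X;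
  cact1 : forall x, cact 1%g x = x;
  cactM : forall s t x, cact (s * t)%g x = cact s (cact t x);
  cact_continuous : continuous (fun p : circle R * X => cact p.1 p.2)
}.

Definition free_action (R : realType) (X : topologicalType)
    (a : circle_action R X) : Prop :=
  forall t x, a t x = x -> t = 1%g.

Record torus_action (R : realType) (m : nat) (T : Type) := TorusAction {
  tact :> torus R m -> T -> T;
  tact1 : forall x, tact 1%g x = x;
  tactM : forall s t x, tact (s * t)%g x = tact s (tact t x)
}.


Section OrbitSpace.
Variables (R : realType) (n m : nat) (lam : 'M[int]_(n, m)).
Variables (T : topologicalType) (a : torus_action R m T).

Definition same_orbit (x y : T) : Prop :=
  exists2 t, torus_ker lam t & a t x = y.

Fact same_orbit_refl x : same_orbit x x.
Proof. by exists 1%g; [exact: torus_ker1 | exact: tact1]. Qed.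

Fact same_orbit_sym x y : same_orbit x y -> same_orbit y x.
Proof.
case=> t tk <-; exists t^-1%g; first exact: torus_kerV.
by rewrite -tactM mulVg tact1.
Qed.

Fact same_orbit_trans x y z :
  same_orbit x y -> same_orbit y z -> same_orbit x z.
Proof.
case=> s sk <- [t tk <-]; exists (t * s)%g; first exact: torus_kerM.
by rewrite tactM.
Qed.

Definition orbit_equiv : equiv_rel T :=
  equiv_rel_of same_orbit_refl same_orbit_sym same_orbit_trans.

Definition orbit_space : topologicalType := quotient_space orbit_equiv.

Definition orbit : T -> orbit_space := @qclass _ orbit_equiv.

Lemma orbitP x y : orbit x = orbit y <-> same_orbit x y.
Proof. by split=> [/qclassP/equiv_rel_ofP|xy]; last exact/qclassP/equiv_rel_ofP. Qed.

End OrbitSpace.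

(** The coordinatewise action on a product whose [i]-th factor is acted upon by
    the circle of index [f i] of the torus. *)
Section ProductAction.
Variables (R : realType) (m : nat) (I : Type) (f : I -> 'I_m).
Variables (Y : I -> topologicalType) (aY : forall i, circle_action R (Y i)).

Let act (t : torus R m) (y : kprod Y) : kprod Y := fun i => aY i (t (f i)) (y i).
Let act1 y : act 1%g y = y.
Proof. by apply/functional_extensionality_dep => i; exact: cact1. Qed.
Let actM s t y : act (s * t)%g y = act s (act t y).
Proof. by apply/functional_extensionality_dep => i; exact: cactM. Qed.

Definition prod_action : torus_action R m (kprod Y) := TorusAction act1 actM.

End ProductAction.

Section Polytope.
Variables (R : realType) (n : nat).
Implicit Types (P A : set 'rV[R]_n).

Definition conv_hull (k : nat) (v : 'I_k -> 'rV[R]_n) : set 'rV[R]_n :=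
  [set x | exists w : 'I_k -> R,
    [/\ forall i, 0 <= w i, \sum_(i < k) w i = 1 &
        x = \sum_(i < k) w i *: v i]].

Definition has_dim (d : nat) A : Prop :=
  exists (x0 : 'rV[R]_n) (B : 'M[R]_(d, n)),
    [/\ A x0, forall i, A (x0 + row i B), row_free B &
        forall x, A x -> (x - x0 <= B)%MS].

(** [P] itself is a face (take [a = 0]); the empty set is not. *)
Definition is_face P A : Prop :=
  A !=set0 /\
  exists (a : 'cV[R]_n) (b : R),
    (forall x, P x -> (x *m a) 0 0 <= b) /\
    A = P `&` [set x | (x *m a) 0 0 = b].

Definition is_vertex P (v : 'rV[R]_n) : Prop := is_face P [set v].

Definition is_facet P A : Prop :=
  is_face P A /\ exists2 d, d.+1 = n & has_dim d A.

Definition polytope P : Prop :=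
  (exists k (v : 'I_k -> 'rV[R]_n), P = conv_hull v) /\ has_dim n P.

Record simple_polytope (m : nat) P (F : 'I_m -> set 'rV[R]_n) : Prop :=
  SimplePolytope {
    sp_polytope : polytope P;
    sp_facets : forall A, is_facet P A <-> exists i, F i = A;
    sp_facets_inj : injective F;
    sp_simple : forall v, is_vertex P v -> #|[pred i | `[< F i v >]]| = n
  }.

Definition facet_cap (m : nat) P (F : 'I_m -> set 'rV[R]_n)
    (s : {set 'I_m}) : set 'rV[R]_n :=
  P `&` [set x | forall i, i \in s -> F i x].

(** The empty set is a simplex: for it the intersection is [P]. *)
Definition dual_complex (m : nat) P (F : 'I_m -> set 'rV[R]_n)
    (s : {set 'I_m}) : Prop :=
  facet_cap P F s !=set0.

Definition int_span (m : nat) (lam : 'M[int]_(n, m)) (s : {set 'I_m}) :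
    set 'cV[int]_n :=
  [set v | exists w : 'I_m -> int, v = \sum_(i in s) w i *: col i lam].

Definition direct_summand (N : set 'cV[int]_n) : Prop :=
  exists N' : set 'cV[int]_n,
    [/\ N' 0, forall u v, N' u -> N' v -> N' (u - v),
        forall v, exists u w, [/\ N u, N' w & v = u + w] &
        forall v, N v -> N' v -> v = 0].

(** [lambda(F_i)] is the [i]-th column of [lam]; the rank of a finitely generated
    submodule of Z^n is computed over the rationals. *)
Definition characteristic_function (m : nat) P (F : 'I_m -> set 'rV[R]_n)
    (lam : 'M[int]_(n, m)) : Prop :=
  forall (s : {set 'I_m}) (d : nat), (d + #|s|)%N = n ->
    is_face P (facet_cap P F s) -> has_dim d (facet_cap P F s) ->
    \rank (map_mx intr (colsub (@enum_val _ (mem s)) lam) : 'M[rat]_(n, #|s|))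
      = #|s| /\
    direct_summand (int_span lam s).

End Polytope.

Definition unit_itv (R : realType) : Type := set_type (`[0, 1]%classic : set R).
HB.instance Definition _ (R : realType) := Topological.on (unit_itv R).

Record cubical_structure (R : realType) (n m : nat) (P : set 'rV[R]_n)
    (F : 'I_m -> set 'rV[R]_n)
    (c : P -> prod_topology (fun _ : 'I_m => unit_itv R)) : Prop :=
  CubicalStructure {
    cub_embedding : embedding c;
    cub_image : range c =
      [set u | exists2 s : {set 'I_m}, dual_complex P F s &
         forall i, i \notin s -> \val (u i) = 1];
    cub_facet : forall p i, \val (c p i) = 0 <-> F i (\val p)
  }.

Section Cone.
Variables (R : realType) (X : topologicalType).
Let I := unit_itv R.

(** If [X] is empty, so is its cone: collapsing [X * {0}] adds no cone point. *)
Definition cone_rel (a b : kprod2 X I) : Prop :=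
  a = b \/ (\val a.2 = 0 /\ \val b.2 = 0).

Fact cone_rel_refl a : cone_rel a a. Proof. by left. Qed.
Fact cone_rel_sym a b : cone_rel a b -> cone_rel b a.
Proof. by case=> [->|[? ?]]; [left|right]. Qed.
Fact cone_rel_trans a b d : cone_rel a b -> cone_rel b d -> cone_rel a d.
Proof. by case=> [->//|[a0 b0]] [<-|[_ d0]]; right. Qed.

Definition cone_equiv : equiv_rel (kprod2 X I) :=
  equiv_rel_of cone_rel_refl cone_rel_sym cone_rel_trans.

Definition cone : topologicalType := quotient_space cone_equiv.

Definition cone_pt (x : X) (s : I) : cone := @qclass _ cone_equiv (x, s).

Lemma cone_ptP x s y t :
  cone_pt x s = cone_pt y t <-> cone_rel (x, s) (y, t).
Proof. by split=> [/qclassP/equiv_rel_ofP|xy]; last exact/qclassP/equiv_rel_ofP. Qed.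

Lemma cone_ptE (z : cone) : cone_pt (rep z).1 (rep z).2 = z.
Proof. by rewrite /cone_pt -surjective_pairing repK. Qed.

Definition cone_base : set cone :=
  [set z | exists (x : X) (s : I), \val s = 1 /\ z = cone_pt x s].

Variable a : circle_action R X.

Definition cone_act (t : circle R) (z : cone) : cone :=
  cone_pt (a t (rep z).1) (rep z).2.

Lemma cone_actE t x s : cone_act t (cone_pt x s) = cone_pt (a t x) s.
Proof.
apply/cone_ptP; rewrite /cone_act.
have /equiv_rel_ofP := rep_class cone_equiv (x, s).
rewrite -/(cone_pt x s); case: (rep _) => y r /= [[<- <-]|[/= s0 r0]].
  by left.
by right.
Qed.

Lemma cone_act1 z : cone_act 1%g z = z.
Proof. by rewrite /cone_act cact1 cone_ptE. Qed.

Lemma cone_actM s t z : cone_act (s * t)%g z = cone_act s (cone_act t z).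
Proof. by rewrite -(cone_ptE z) !cone_actE cactM. Qed.

Lemma cone_act_base t z : cone_base z -> cone_base (cone_act t z).
Proof. by case=> x [s [s1 ->]]; exists (a t x), s; rewrite cone_actE. Qed.

End Cone.

(** Maps out of quotient spaces are defined on chosen representatives; the
  lemmas [cone_actE], [orbit_projE], [action1E], [hE], [h_invE], [alphaE] and
  [alpha_barE] give their values on arbitrary classes. *)
Section Diagram.
Variables (R : realType) (n m : nat).
Variables (P : set 'rV[R]_n) (F : 'I_m -> set 'rV[R]_n).
Variable lam : 'M[int]_(n, m).
Variables (X : 'I_m -> topologicalType) (a : forall i, circle_action R (X i)).

Definition polyhedral_factor (s : {set 'I_m}) (i : 'I_m) : set (cone R (X i)) :=
  if i \in s then setT else @cone_base R (X i).

(** A closed subset of the product of the cones, so that its subspace topology is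
    compactly generated. *)
Definition polyhedral_set : set (kprod (fun i => cone R (X i))) :=
  [set z | exists2 s : {set 'I_m}, dual_complex P F s &
             forall i, polyhedral_factor s (z i)].

Definition polyhedral_product : topologicalType := set_type polyhedral_set.

Fact poly_act_subproof (t : torus R m) (z : polyhedral_product) :
  (fun i => cone_act (a i) (t i) (\val z i)) \in polyhedral_set.
Proof.
apply/mem_set; have /set_mem [s Ks zs] := valP z.
exists s => // i; have := zs i; rewrite /polyhedral_factor.
by case: ifP => // _; exact: cone_act_base.
Qed.

Let poly_act t z : polyhedral_product :=
  exist (fun y => y \in polyhedral_set) _ (poly_act_subproof t z).

Let poly_act1 z : poly_act 1%g z = z.
Proof.
by apply/val_inj/functional_extensionality_dep => i; exact: cone_act1.
Qed.

Let poly_actM s t z : poly_act (s * t)%g z = poly_act s (poly_act t z).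
Proof.
by apply/val_inj/functional_extensionality_dep => i; exact: cone_actM.
Qed.

Definition poly_action : torus_action R m polyhedral_product :=
  TorusAction poly_act1 poly_actM.

Definition poly_orbits : topologicalType := orbit_space lam poly_action.

Definition delta_map : polyhedral_product -> poly_orbits :=
  @orbit R n m lam _ poly_action.

Definition cofacets (p : P) : pred 'I_m := fun i => ~~ `[< F i (\val p) >].

Definition X_all : topologicalType := kprod X.
Definition X_action : torus_action R m X_all := prod_action (fun i => i) a.
Definition X_orbits : topologicalType := orbit_space lam X_action.

Definition X_sub (J : pred 'I_m) : topologicalType :=
  kprod (fun i : {i | J i} => X (\val i)).
Definition X_sub_action (J : pred 'I_m) : torus_action R m (X_sub J) :=
  prod_action (fun i : {i | J i} => \val i) (fun i => a (\val i)).
Definition X_sub_orbits (J : pred 'I_m) : topologicalType :=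
  orbit_space lam (X_sub_action J).

Definition X_proj (J : pred 'I_m) (x : X_all) : X_sub J := fun i => x (\val i).

Definition orbit_proj (J : pred 'I_m) (u : X_orbits) : X_sub_orbits J :=
  orbit lam (X_sub_action J) (@X_proj J (rep u)).

Lemma orbit_projE J x :
  orbit_proj J (orbit lam X_action x) = orbit lam (X_sub_action J) (@X_proj J x).
Proof.
apply/orbitP; have /equiv_rel_ofP/same_orbit_sym := rep_class (orbit_equiv lam X_action) x.
case=> t tk tx; exists t => //; rewrite -[in RHS]tx.
by apply/functional_extensionality_dep.
Qed.

Definition rel1 (u v : kprod2 X_all P) : Prop :=
  u.2 = v.2 /\ forall i, cofacets u.2 i -> u.1 i = v.1 i.

Fact rel1_refl u : rel1 u u. Proof. by []. Qed.
Fact rel1_sym u v : rel1 u v -> rel1 v u.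
Proof. by case=> E e; split=> [|i]; rewrite -E // => /e. Qed.
Fact rel1_trans u v w : rel1 u v -> rel1 v w -> rel1 u w.
Proof.
case=> E e [E' e']; split=> [|i iu]; first exact: etrans E'.
by rewrite e // e' // -E.
Qed.

Definition equiv1 : equiv_rel (kprod2 X_all P) :=
  equiv_rel_of rel1_refl rel1_sym rel1_trans.
Definition space1 : topologicalType := quotient_space equiv1.
Definition class1 (x : X_all) (p : P) : space1 := @qclass _ equiv1 (x, p).

Lemma class1P x p y q : class1 x p = class1 y q <-> rel1 (x, p) (y, q).
Proof. by split=> [/qclassP/equiv_rel_ofP|xy]; last exact/qclassP/equiv_rel_ofP. Qed.

Lemma class1_rep (u : space1) : class1 (rep u).1 (rep u).2 = u.
Proof. by rewrite /class1 -surjective_pairing repK. Qed.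

Lemma rep_class1 x p : rel1 (x, p) (rep (class1 x p)).
Proof. by have /equiv_rel_ofP := rep_class equiv1 (x, p). Qed.

Let act1 (t : torus R m) (u : space1) : space1 :=
  class1 (X_action t (rep u).1) (rep u).2.

Let act1E t x p : act1 t (class1 x p) = class1 (X_action t x) p.
Proof.
apply/class1P; have := rep_class1 x p; rewrite /act1.
case: (rep _) => y q [/= <- e]; split=> //= i ip.
by rewrite -e.
Qed.

Let act1_1 u : act1 1%g u = u.
Proof. by rewrite /act1 tact1 class1_rep. Qed.

Let act1_M s t u : act1 (s * t)%g u = act1 s (act1 t u).
Proof. by rewrite -(class1_rep u) !act1E tactM. Qed.

Definition action1 : torus_action R m space1 := TorusAction act1_1 act1_M.

Lemma action1E t x p : action1 t (class1 x p) = class1 (X_action t x) p.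
Proof. exact: act1E. Qed.

Definition orbits1 : topologicalType := orbit_space lam action1.

Definition rel2 (u v : kprod2 X_orbits P) : Prop :=
  u.2 = v.2 /\ orbit_proj (cofacets u.2) u.1 = orbit_proj (cofacets u.2) v.1.

Fact rel2_refl u : rel2 u u. Proof. by []. Qed.
Fact rel2_sym u v : rel2 u v -> rel2 v u.
Proof. by case=> E e; split; rewrite -E. Qed.
Fact rel2_trans u v w : rel2 u v -> rel2 v w -> rel2 u w.
Proof.
by case=> E e [E' e']; split; [exact: etrans E'|rewrite e E e'].
Qed.

Definition equiv2 : equiv_rel (kprod2 X_orbits P) :=
  equiv_rel_of rel2_refl rel2_sym rel2_trans.
Definition space2 : topologicalType := quotient_space equiv2.
Definition class2 (u : X_orbits) (p : P) : space2 := @qclass _ equiv2 (u, p).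

Lemma class2P u p v q : class2 u p = class2 v q <-> rel2 (u, p) (v, q).
Proof. by split=> [/qclassP/equiv_rel_ofP|xy]; last exact/qclassP/equiv_rel_ofP. Qed.

Lemma class2_rep (u : space2) : class2 (rep u).1 (rep u).2 = u.
Proof. by rewrite /class2 -surjective_pairing repK. Qed.

Definition h_map (w : space2) : orbits1 :=
  orbit lam action1 (class1 (rep (rep w).1) (rep w).2).

Definition h_inv (w : orbits1) : space2 :=
  let u := rep (rep w) in class2 (orbit lam X_action u.1) u.2.

Lemma hE x p :
  h_map (class2 (orbit lam X_action x) p) = orbit lam action1 (class1 x p).
Proof.
rewrite /h_map; set o := orbit lam X_action x; set u := rep (class2 o p).
have /class2P [/= pE uE] : class2 u.1 u.2 = class2 o p by exact: class2_rep.
have u1E : orbit lam X_action (rep u.1) = u.1 by exact: repK.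
move: uE; rewrite -{1}u1E /o !orbit_projE => uE.
have [t tk tx] := (@orbitP _ _ _ _ (X_sub _) _ _ _).1 uE.
rewrite pE; apply: (@orbitP _ _ _ lam space1 action1 _ _).2; exists t => //.
apply: etrans (action1E _ _ _) _; apply/class1P; split=> //= i ip.
rewrite -pE in ip.
exact: (congr1 (fun f : X_sub _ => f (exist _ i ip)) tx).
Qed.

Lemma h_invE x p :
  h_inv (orbit lam action1 (class1 x p)) = class2 (orbit lam X_action x) p.
Proof.
rewrite /h_inv; set o := orbit _ _ (class1 x p).
have oE : orbit lam action1 (rep o) = o by exact: repK.
have [t tk tx] := (@orbitP _ _ _ _ space1 _ _ _).1 oE.
set u := rep (rep o); have uE : class1 u.1 u.2 = rep o by exact: class1_rep.
move: tx; rewrite -uE action1E => /class1P [/= pE e].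
apply/class2P; split=> //=; rewrite !orbit_projE.
apply: (@orbitP _ _ _ lam (X_sub _) _ _ _).2; exists t => //.
by apply/functional_extensionality_dep => -[i ip]; exact: e.
Qed.

Lemma hK : cancel h_map h_inv.
Proof.
move=> w; rewrite -(class2_rep w); case: (rep w) => o p /=.
by rewrite -(repK o) -[@qclass _ _ _]/(orbit lam X_action _) hE h_invE.
Qed.

Lemma h_invK : cancel h_inv h_map.
Proof.
move=> w; rewrite -(repK w) -[@qclass _ _ _]/(orbit lam action1 _).
by rewrite -(class1_rep (rep w)) h_invE hE.
Qed.

Definition beta_map : space1 -> space2 := h_inv \o orbit lam action1.

Variable c : P -> prod_topology (fun _ : 'I_m => unit_itv R).
Hypothesis cP : cubical_structure F c.

Let alpha_fun (u : space1) : kprod (fun i => cone R (X i)) :=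
  fun i => cone_pt ((rep u).1 i) (c (rep u).2 i).

Fact alpha_subproof u : alpha_fun u \in polyhedral_set.
Proof.
apply/mem_set; rewrite /alpha_fun; case: (rep u) => x p /=.
have [s Ks cs] : exists2 s : {set 'I_m}, dual_complex P F s &
    forall i, i \notin s -> \val (c p i) = 1.
  have : range c (c p) by exists p.
  by rewrite (cub_image cP).
exists s => // i; rewrite /polyhedral_factor; case: ifPn => // /cs ci1.
by exists (x i), (c p i).
Qed.

Definition alpha_map (u : space1) : polyhedral_product :=
  exist (fun y => y \in polyhedral_set) _ (alpha_subproof u).

Lemma alphaE x p i : \val (alpha_map (class1 x p)) i = cone_pt (x i) (c p i).
Proof.
rewrite /= /alpha_fun; have := rep_class1 x p.
case: (rep _) => y q [/= <- e]; apply/cone_ptP.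
have [ip|] := boolP (cofacets p i); first by rewrite e //; left.
by move=> /negPn/asboolP/(cub_facet cP) ci0; right.
Qed.

Lemma alpha_equivariant t u : alpha_map (action1 t u) = poly_action t (alpha_map u).
Proof.
rewrite -(class1_rep u) action1E; apply/val_inj/functional_extensionality_dep.
move=> i; apply: etrans (alphaE _ _ _) _.
apply: etrans _ (esym (congr1 (cone_act (a i) (t i)) (alphaE _ _ _))).
by rewrite cone_actE.
Qed.

Definition alpha_bar (w : orbits1) : poly_orbits := delta_map (alpha_map (rep w)).

Lemma alpha_barE u : alpha_bar (orbit lam action1 u) = delta_map (alpha_map u).
Proof.
rewrite /alpha_bar; set o := orbit lam action1 u.
have : orbit lam action1 (rep o) = orbit lam action1 u by exact: repK.
case/orbitP=> t tk tu; apply/orbitP; exists t => //.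
by rewrite -alpha_equivariant tu.
Qed.

Definition gamma_map : space2 -> poly_orbits := alpha_bar \o h_map.

End Diagram.

Arguments alpha_map [R n m P F] X [c] cP u.
Arguments beta_map [R n m P F] lam [X] a u.
Arguments gamma_map [R n m P F] lam [X] a [c] cP w : rename.
Arguments delta_map [R n m P F] lam [X] a z : rename.

(* Main.v *)
(** The maps [alpha] and [h] are continuous bijections because their formulas are
  compatible with the relations; the point is that they are open.  Both
  statements reduce to the fact that, for compactly generated products, a
  product of quotient maps is a quotient map.  For [h] this is applied to the
  orbit map of X_1 * ... * X_m times the identity of P.  For [alpha], the
  polyhedral product is closed in the product of the cones, and over it the cone
  parameters determine the point of P because the cubical structure is an
  embedding; so the openness of an image under [alpha] can be tested on compact
  Hausdorff spaces mapped to the product of the X_i * I.  Since [alpha] is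
  equivariant, it induces a homeomorphism of orbit spaces. *)

Require Import Defs.
From HB Require Import structures.
From mathcomp Require Import all_boot all_order all_algebra.
From mathcomp Require Import all_classical all_reals all_analysis.
From mathcomp Require Import complex.

Set Implicit Arguments.
Unset Strict Implicit.
Unset Printing Implicit Defensive.

Import Order.TTheory GRing.Theory Num.Theory.
Import numFieldNormedType.Exports.

Local Open Scope classical_set_scope.
Local Open Scope ring_scope.

Local Notation orbit := Defs.orbit.

(** * Compact Hausdorff test spaces *)

Definition compact_hausdorff (K : topologicalType) : Prop :=
  compact [set: K] /\ hausdorff_space K.

(** Hausdorffness is phrased through clusters of neighbourhood filters, so this reduces it for
    products and subspaces to the projections and the inclusion. *)
Lemma cluster_nbhs_continuous (S T : topologicalType) (f : S -> T) (x y : S) :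
  continuous f -> cluster (nbhs x) y -> cluster (nbhs (f x)) (f y).
Proof.
move=> cf xy A B /cf fA /cf fB.
by have [z [Az Bz]] := xy _ _ fA fB; exists (f z).
Qed.

Lemma continuous_fst (S T : topologicalType) : continuous (@fst S T).
Proof. by move=> p; exact: cvg_fst. Qed.

Lemma continuous_snd (S T : topologicalType) : continuous (@snd S T).
Proof. by move=> p; exact: cvg_snd. Qed.

Lemma continuous_pair (R S T : topologicalType) (f : R -> S) (g : R -> T) :
  continuous f -> continuous g -> continuous (fun x => (f x, g x)).
Proof. by move=> cf cg x; apply: cvg_pair; [exact: cf | exact: cg]. Qed.

Lemma comp_continuous (R S T : topologicalType) (f : R -> S) (g : S -> T) :
  continuous f -> continuous g -> continuous (fun x => g (f x)).
Proof. by move=> cf cg x; apply: continuous_comp; [exact: cf | exact: cg]. Qed.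

Lemma prod_topology_continuous (I : Type) (T : topologicalType)
    (Y : I -> topologicalType) (f : T -> prod_topology Y) :
  (forall i, continuous (fun x => f x i)) -> continuous f.
Proof.
move=> cf x; apply/cvg_sup => i U [V [[W oW <-] /= Wfx] sVU].
apply: (filterS sVU); apply: (cf i x).
by apply: open_nbhs_nbhs; split.
Qed.

Lemma prod_coord_continuous (I : eqType) (Y : I -> topologicalType) (i : I) :
  continuous (fun y : prod_topology Y => y i).
Proof. exact: proj_continuous. Qed.

Lemma compact_hausdorff_prod (K L : topologicalType) :
  compact_hausdorff K -> compact_hausdorff L -> compact_hausdorff (K * L)%type.
Proof.
move=> [cK hK] [cL hL]; split; first by rewrite -setXTT; exact: compact_setX.
move=> [x1 x2] [y1 y2] xy; congr pair.
  exact: hK (cluster_nbhs_continuous (@continuous_fst K L) xy).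
exact: hL (cluster_nbhs_continuous (@continuous_snd K L) xy).
Qed.

Lemma compact_hausdorff_closed (K : topologicalType) (S : set K) :
  compact_hausdorff K -> closed S -> compact_hausdorff (set_type S).
Proof.
move=> [cK hK] clS; split; last first.
  move=> x y xy; apply: val_inj.
  exact: hK (cluster_nbhs_continuous (@initial_continuous _ _ set_val) xy).
have cS : compact S by exact: subclosed_compact clS cK _.
move=> G GG _.
have [|x [Sx xG]] := cS (set_val @ G) (fmap_proper_filter _ _).
  by apply: (@filterS _ G _ setT) => [y _|]; [exact: set_valP|exact: filterT].
exists (exist _ x (mem_set Sx)); split => // A B GA [_ [[C oC <-] /= Cx] sB].
have [||y [[z Az <-] Cz]] := xG (set_val @` A) C.
- by apply: (@filterS _ G _ A) => //; exact: preimage_image.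
- exact: open_nbhs_nbhs.
by exists z; split => //; exact: sB.
Qed.

(** * Continuity and k-ification *)

Lemma open_kify (T : topologicalType) (U : set T) :
  @open (kify T) U <-> kopen U.
Proof. by []. Qed.

Lemma kify_id_continuous (T : topologicalType) : continuous (id : kify T -> T).
Proof.
by apply/continuousP => U oU; apply/open_kify => K f _ _ /continuousP; exact.
Qed.

Lemma continuous_to_kify (K T : topologicalType) (f : K -> T) :
  compact_hausdorff K -> continuous f -> continuous (f : K -> kify T).
Proof. by move=> [cK hK] cf; apply/continuousP => U /open_kify; apply. Qed.

(** A test map [g] into [S] is also continuous into [kify S], its source being compact Hausdorff;
    hence [f \o g] is a test map for [T]. *)
Lemma kify_continuous (S T : topologicalType) (f : S -> T) :
  continuous (f : kify S -> T) -> continuous (f : kify S -> kify T).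
Proof.
move=> cf; apply/continuousP => U /open_kify kU.
apply/open_kify => K g cK hK cg.
apply: (kU K (f \o g)) => //.
by apply: (@comp_continuous _ (kify S)) => //; exact: continuous_to_kify.
Qed.

Lemma kprod2_fst_continuous (S T : topologicalType) :
  continuous (fun z : kprod2 S T => z.1).
Proof.
exact: (comp_continuous (@kify_id_continuous (S * T)%type)
  (@continuous_fst S T)).
Qed.

Lemma kprod2_snd_continuous (S T : topologicalType) :
  continuous (fun z : kprod2 S T => z.2).
Proof.
exact: (comp_continuous (@kify_id_continuous (S * T)%type)
  (@continuous_snd S T)).
Qed.

Lemma kprod_coord_continuous (I : eqType) (Y : I -> topologicalType) (i : I) :
  continuous (fun y : kprod Y => y i).
Proof.
exact: (comp_continuous (@kify_id_continuous (prod_topology Y))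
  (@prod_coord_continuous I Y i)).
Qed.

(** * Quotient maps and their compactly generated products *)

Lemma qclass_continuous (T : topologicalType) (e : equiv_rel T) :
  continuous (qclass e).
Proof. exact: pi_continuous. Qed.

Lemma quotient_space_continuous (S T : topologicalType) (e : equiv_rel S)
    (f : quotient_space e -> T) :
  continuous (fun x => f (qclass e x)) -> continuous f.
Proof. by move=> cf; apply/quotient_continuous. Qed.

(** The last clause says that the topology of [B] is at least as fine as the one
    coinduced by [q] from [kify A]. *)
Definition kquotient (A B : topologicalType) (q : A -> B) : Prop :=
  (forall y, exists x, q x = y) /\
  forall V : set B,
    (forall (K : topologicalType) (g : K -> A), compact_hausdorff K ->
       continuous g -> open [set k | V (q (g k))]) ->
    open V.

Lemma kquotient_qclass (T : topologicalType) (e : equiv_rel (kify T)) :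
  kquotient (qclass e).
Proof.
split=> [y|V oV]; first by exists (rep y); exact: repK.
apply/open_kify => K g cK hK cg.
by apply: (oV K g) => //; exact: continuous_to_kify.
Qed.

(* Whitehead's theorem: a neighbourhood of [(y, k)] in [W] is found as [V * N],
   with [N] a closed neighbourhood of [k] and [V] the set of all [y] such that
   [{y} * N] lies in [W]; [V] is open by the tube lemma. *)
Lemma kquotient_prod_open (A B K : topologicalType) (q : A -> B)
    (W : set (B * K)) :
  kquotient q -> compact_hausdorff K ->
  (forall (M : topologicalType) (g : M -> A), compact_hausdorff M ->
     continuous g -> open [set p : M * K | W (q (g p.1), p.2)]) ->
  open W.
Proof.
move=> [qsurj qopen] chK oW; rewrite openE => -[y0 k0] W0.
have [cK hK] := chK; have [x0 qx0] := qsurj y0.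
(* The slice is obtained from the hypothesis for [M := K] and a constant map, pulled back along the
   diagonal. *)
have oT : open [set k | W (y0, k)].
  rewrite -qx0; have /oW : continuous (fun _ : K => x0) by exact: cst_continuous.
  move=> /(_ chK) oW0.
  have /continuousP/(_ _ oW0) // : continuous (fun k : K => (k, k)).
  by apply: continuous_pair => k; exact: cvg_id.
have [N N0 sNT] : filter_from (nbhs k0) closure [set k | W (y0, k)].
  apply: (compact_regular hK cK); first exact: filterT.
  by apply: open_nbhs_nbhs.
have cN : compact (closure N).
  by apply: subclosed_compact cK _ => //; exact: closed_closure.
pose V := [set y | closure N `<=` [set k | W (y, k)]].
have oV : open V.
  apply: qopen => M g chM cg; rewrite openE => m Vm.
  have /compact_near_coveringP := cN.
  apply => k Nk.
  have /open_nbhs_nbhs : open_nbhs (m, k) [set p : M * K | W (q (g p.1), p.2)].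
    by split; [exact: oW|exact: Vm].
  case=> -[Q1 Q2] /= [Q1m Q2k] sQ; exists (Q2, Q1) => // -[k' m'] [/= ? ?].
  exact: (sQ (m', k')).
exists (V, closure N); last by move=> [y k] [/= Vy Nk]; exact: Vy.
split; first exact: open_nbhs_nbhs.
by apply: filterS N0; exact: subset_closure.
Qed.

(* The factors are handled one at a time: [r] lists those in which the test map
   is continuous only after composition with [q]. *)
Lemma kquotient_kprod (I : finType) (A B : I -> topologicalType)
    (q : forall i, A i -> B i) (U : set (kprod B)) :
  (forall i, kquotient (@q i)) -> (forall i, continuous (@q i)) ->
  (forall (K : topologicalType) (g : K -> prod_topology A),
     compact_hausdorff K -> continuous g ->
     open [set k | U (fun i => q i (g k i))]) ->
  open U.
Proof.
move=> qk qc oU.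
have mixed (r : seq I) (K : topologicalType) (g : K -> forall i, A i) :
    compact_hausdorff K -> (forall i, continuous (fun k => q i (g k i))) ->
    (forall i, i \notin r -> continuous (fun k => g k i)) ->
    open [set k | U (fun i => q i (g k i))].
  elim: r K g => [|j r IH] K g chK cqg cg.
    by apply: oU => //; apply: prod_topology_continuous => i; exact: cg.
  (* Coordinate [j] becomes a free variable in [B j]. Then [kquotient_prod_open] lets it run through
     [q j] of a continuous map [h] into [A j], at the price of an extra compact factor [M], and [j]
     leaves the list. *)
  pose W := [set p : B j * K | U (dfwith (fun i => q i (g p.2 i)) j p.1)].
  have -> : [set k | U (fun i => q i (g k i))] =
      (fun k => (q j (g k j), k)) @^-1` W.
    apply/funext => k; rewrite /preimage /W /=; congr U.
    apply/functional_extensionality_dep => i.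
    by case: dfwithP.
  have /continuousP : continuous (fun k => (q j (g k j), k)).
    by apply: continuous_pair; [exact: cqg|move=> k; exact: cvg_id].
  apply; apply: (kquotient_prod_open (qk j) chK) => M h chM ch.
  have -> : [set p : M * K | W (q j (h p.1), p.2)] =
     [set p : M * K | U (fun i => q i (dfwith (g p.2) j (h p.1) i))].
    apply/funext => -[m k]; rewrite /W /=; congr U.
    apply/functional_extensionality_dep => i.
    case: dfwithP => [|i' ij]; first by rewrite dfwithin.
    by rewrite dfwithout.
  apply: IH; first exact: compact_hausdorff_prod.
    move=> i; have [<-|ji] := eqVneq j i.
      under eq_fun do rewrite dfwithin.
      apply: (comp_continuous (g := fun m => q j (h m)) (@continuous_fst M K)).
      exact: comp_continuous ch (@qc j).
    under eq_fun do rewrite dfwithout//.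
    exact: (comp_continuous (@continuous_snd M K) (cqg i)).
  move=> i ir; have [<-|ji] := eqVneq j i.
    under eq_fun do rewrite dfwithin.
    exact: (comp_continuous (@continuous_fst M K) ch).
  under eq_fun do rewrite dfwithout//.
  apply: (comp_continuous (@continuous_snd M K) (cg i _)).
  by rewrite inE negb_or eq_sym ji.
apply/open_kify => K f cK hK cf.
(* These preimages are chosen pointwise, so no coordinate of the lift need be continuous; hence
   [mixed] is applied with all of [I] listed. *)
have qsurj (k : K) i : {x | q i x = f k i} by apply: cid; exact: (qk i).1.
have -> : f @^-1` U = [set k | U (fun i => q i (sval (qsurj k i)))].
  apply/funext => k; rewrite /preimage /=; congr U.
  by apply/functional_extensionality_dep => i; rewrite (svalP (qsurj k i)).
apply: (mixed (enum I)) => // i; last by rewrite mem_enum.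
under eq_fun do rewrite (svalP (qsurj _ i)).
exact: (comp_continuous cf (@prod_coord_continuous _ B i)).
Qed.

(** * Homeomorphisms and passage to orbit spaces *)

Lemma homeomorphism_of_open (S T : topologicalType) (f : S -> T) :
  injective f -> (forall y, exists x, f x = y) -> continuous f ->
  (forall U, open U -> open (f @` U)) -> homeomorphism f.
Proof.
move=> f_inj /choice[g gK] cf f_open; exists g.
have fK : cancel f g by move=> x; apply: f_inj; rewrite gK.
split=> //; apply/continuousP => U /f_open; congr open.
apply/seteqP; split=> [_ [x Ux <-]|y Ugy]; first by rewrite /preimage /= fK.
by exists (g y).
Qed.

Lemma homeomorphism_comp (R S T : topologicalType) (f : R -> S) (g : S -> T) :
  homeomorphism f -> homeomorphism g -> homeomorphism (g \o f).
Proof.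
move=> [f' [cf cf' fK f'K]] [g' [cg cg' gK g'K]]; exists (f' \o g').
split; [exact: (comp_continuous cf cg)|exact: comp_continuous cg' cf'| |].
  exact: can_comp.
exact: can_comp.
Qed.

Section OrbitHomeomorphism.
Variables (R : realType) (n m : nat) (lam : 'M[int]_(n, m)).
Variables (S T : topologicalType).
Variables (aS : torus_action R m S) (aT : torus_action R m T).
Variables (f : S -> T) (fbar : orbit_space lam aS -> orbit_space lam aT).
Hypothesis f_equivariant : forall t x, f (aS t x) = aT t (f x).
Hypothesis fbarE : forall x, fbar (orbit lam aS x) = orbit lam aT (f x).

(** The inverse of an equivariant bijection is equivariant, so it descends too; both continuity
    claims are checked before passing to orbits. *)
Lemma orbit_homeomorphism : homeomorphism f -> homeomorphism fbar.
Proof.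
move=> [g [cf cg fK gK]].
have g_equivariant t y : g (aT t y) = aS t (g y).
  by rewrite -{1}(gK y) -f_equivariant fK.
pose gbar (w : orbit_space lam aT) := orbit lam aS (g (rep w)).
have gbarE y : gbar (orbit lam aT y) = orbit lam aS (g y).
  have : orbit lam aT (rep (orbit lam aT y)) = orbit lam aT y by exact: repK.
  move=> /Defs.orbitP[t tk ty]; apply/Defs.orbitP; exists t => //.
  by rewrite -g_equivariant ty.
exists gbar; split.
- apply: quotient_space_continuous.
  rewrite [X in continuous X](_ : _ = orbit lam aT \o f); last exact/funext.
  by apply: comp_continuous cf _; exact: qclass_continuous.
- apply: quotient_space_continuous.
  rewrite [X in continuous X](_ : _ = orbit lam aS \o g); last exact/funext.
  by apply: comp_continuous cg _; exact: qclass_continuous.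
- by move=> w; rewrite -(repK w) -[qclass _ _]/(orbit lam aS _) fbarE gbarE fK.
- by move=> w; rewrite -(repK w) -[qclass _ _]/(orbit lam aT _) gbarE fbarE gK.
Qed.

End OrbitHomeomorphism.

Section DiagramHomeomorphisms.
Variables (R : realType) (n m : nat) (P : set 'rV[R]_n).
Variables (F : 'I_m -> set 'rV[R]_n) (lam : 'M[int]_(n, m)).
Variables (X : 'I_m -> topologicalType) (a : forall i, circle_action R (X i)).

(** * The homeomorphism [h] *)

Lemma class1_continuous :
  continuous (fun z : kprod2 (X_all X) P => class1 F z.1 z.2).
Proof.
rewrite [X in continuous X](_ : _ = qclass (equiv1 P F X)).
  exact: qclass_continuous.
by apply/funext => z; rewrite /class1 -surjective_pairing.
Qed.

Lemma h_map_continuous : continuous (@h_map R n m P F lam X a).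
Proof.
apply: quotient_space_continuous; apply/continuousP => O oO.
apply/open_kify => K f cK hK cf.
(* The orbit coordinate is separated from the point of [P], which keeps following the test map [f];
   only the orbit has to be lifted to [X_all X]. *)
pose W := [set z : X_orbits lam a * K |
  O (h_map (class2 F z.1 (f z.2).2))].
have -> : f @^-1` ((fun x => h_map (qclass (equiv2 P F lam a) x)) @^-1` O) =
    (fun k => ((f k).1, k)) @^-1` W.
  by apply/funext => k; rewrite /preimage /W /= /class2 -surjective_pairing.
have /continuousP : continuous (fun k => ((f k).1, k)).
  apply: continuous_pair => k; last exact: cvg_id.
  exact: (comp_continuous cf (@continuous_fst _ _)).
have qk := @kquotient_qclass _ (orbit_equiv lam (X_action a)).
apply; apply: (kquotient_prod_open qk); first by split.
move=> M g chM cg.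
have -> : [set z : M * K | W (qclass (orbit_equiv lam (X_action a)) (g z.1), z.2)]
    = (fun z => orbit lam (action1 P F a) (class1 F (g z.1) (f z.2).2)) @^-1` O.
  by apply/funext => z; rewrite /preimage /W /= hE.
suff /continuousP : continuous (fun z : M * K =>
  orbit lam (action1 P F a) (class1 F (g z.1) (f z.2).2)) by apply.
pose k (z : M * K) : kprod2 (X_all X) P := (g z.1, (f z.2).2).
have ck : continuous k.
  apply: continuous_to_kify; first exact: compact_hausdorff_prod.
  apply: continuous_pair; first exact: (comp_continuous (@continuous_fst M K) cg).
  exact: (comp_continuous (@continuous_snd M K)
    (comp_continuous cf (@continuous_snd _ _))).
exact: (comp_continuous (comp_continuous ck class1_continuous)
  (@qclass_continuous _ _)).
Qed.

Lemma h_inv_continuous : continuous (@h_inv R n m P F lam X a).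
Proof.
apply: quotient_space_continuous; apply: quotient_space_continuous.
pose k (z : kprod2 (X_all X) P) : kprod2 (X_orbits lam a) P :=
  (orbit lam (X_action a) z.1, z.2).
rewrite [X in continuous X](_ : _ = qclass (equiv2 P F lam a) \o k); last first.
  by apply/funext => -[x p]; exact: h_invE.
apply: (@comp_continuous _ (kprod2 (X_orbits lam a) P)); last first.
  exact: qclass_continuous.
apply: kify_continuous; apply: continuous_pair.
  exact: (comp_continuous
    (@kprod2_fst_continuous (X_all X) P)
    (@qclass_continuous _ (orbit_equiv lam (X_action a)))).
exact: kprod2_snd_continuous.
Qed.

Lemma h_map_homeomorphism : homeomorphism (@h_map R n m P F lam X a).
Proof.
exists (@h_inv R n m P F lam X a).
split; [exact: h_map_continuous|exact: h_inv_continuous|exact: hK|exact: h_invK].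
Qed.

(** * The homeomorphism [alpha] *)

Variable c : P -> prod_topology (fun _ : 'I_m => unit_itv R).
Hypothesis cP : cubical_structure F c.

(** There are finitely many simplices, and each contributes an intersection of closed conditions on
    coordinates. *)
Lemma cubical_range_closed : closed (range c).
Proof.
rewrite (cub_image cP).
have -> : [set u : prod_topology (fun _ : 'I_m => unit_itv R) |
    exists2 s : {set 'I_m}, dual_complex P F s &
      forall i, i \notin s -> \val (u i) = 1] =
    \bigcup_(s in dual_complex P F) \bigcap_(i in [set i | i \notin s])
      [set u | \val (u i) = 1].
  by apply/seteqP; split=> u [s Ks us]; exists s.
apply: closed_bigcup => [|s _]; first exact: finite_finset.
apply: closed_bigI => i _.
have /continuous_closedP : continuous
    (fun u : prod_topology (fun _ : 'I_m => unit_itv R) => \val (u i)).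
  exact: (comp_continuous (@prod_coord_continuous _ (fun=> unit_itv R) i)
    (@initial_continuous _ _ set_val)).
by move=> /(_ [set x | x = 1]); apply; exact: closed_eq.
Qed.

(** The cone identifies points only at height 0, so a point of the base has parameter 1 in every
    representation. *)
Lemma polyhedral_set_range (x : forall i, X i)
    (s : prod_topology (fun _ : 'I_m => unit_itv R)) :
  polyhedral_set P F (fun i => cone_pt (x i) (s i)) -> range c s.
Proof.
move=> [t Kt ts]; rewrite (cub_image cP); exists t => // i it.
have := ts i; rewrite /polyhedral_factor (negPf it).
move=> [y [r [r1 /cone_ptP]]] [[_ ->]//|[_ r0]].
by move: r1; rewrite (r0 : \val r = 0) => /esym/eqP; rewrite oner_eq0.
Qed.

(** The cone parameters recover [p] since [c] is injective. A coordinate lost at a cone point has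
    parameter 0, so [p] lies on that facet and [rel1] ignores the coordinate. *)
Lemma alpha_inj : injective (alpha_map X cP).
Proof.
move=> u v; rewrite -(class1_rep u) -(class1_rep v).
move: (rep u) (rep v) => [x p] [y q] /= uv.
have ptE i : cone_pt (x i) (c p i) = cone_pt (y i) (c q i).
  rewrite -(alphaE cP x p i) -(alphaE cP y q i).
  exact: (congr1 (fun z => \val z i) uv).
have pq : p = q.
  apply: (cub_embedding cP).1; apply/functional_extensionality_dep => i.
  have /cone_ptP[[_ //]|[/= p0 q0]] := ptE i.
  by apply: val_inj; rewrite /= p0 q0.
subst q; apply/class1P; split=> //= i /negP ip.
have /cone_ptP[[//]|[/= p0 _]] := ptE i.
by case: ip; apply/asboolP/(cub_facet cP).
Qed.

Lemma alpha_surj (z : polyhedral_product P F X) :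
  exists u, alpha_map X cP u = z.
Proof.
pose x i := (rep (\val z i)).1; pose s i := (rep (\val z i)).2.
have zE : \val z = fun i => cone_pt (x i) (s i).
  by apply/functional_extensionality_dep => i; rewrite cone_ptE.
have : polyhedral_set P F (\val z) by exact: set_valP.
rewrite zE => /polyhedral_set_range[p _ cps].
exists (class1 F x p); apply: val_inj; rewrite zE.
by apply/functional_extensionality_dep => i; rewrite alphaE cps.
Qed.

Lemma alpha_continuous : continuous (alpha_map X cP).
Proof.
(* The target has the subspace topology, so it suffices to treat the map into the product of the
   cones. *)
apply/continuousP => _ [V oV <-]; move: V oV; apply/continuousP.
apply: quotient_space_continuous.
pose f (z : kprod2 (X_all X) P) i := cone_pt (z.1 i) (c z.2 i).
rewrite [X in continuous X](_ : _ = f); last first.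
  apply/funext => -[x p]; apply/functional_extensionality_dep => i.
  exact: alphaE.
apply: kify_continuous; apply: prod_topology_continuous => i.
pose k (z : kprod2 (X_all X) P) : kprod2 (X i) (unit_itv R) :=
  (z.1 i, c z.2 i).
apply: (@comp_continuous _ _ _ k); last exact: qclass_continuous.
apply: kify_continuous; apply: continuous_pair.
  exact: (comp_continuous
    (@kprod2_fst_continuous (X_all X) P)
    (@kprod_coord_continuous _ X i)).
have cc : continuous c.
  by apply/continuousP => V oV; apply/(cub_embedding cP).2; exists V.
exact: (comp_continuous
  (@kprod2_snd_continuous (X_all X) P)
  (comp_continuous cc (@prod_coord_continuous _ (fun=> unit_itv R) i))).
Qed.

Lemma alpha_open (O : set (space1 P F X)) :
  open O -> open (alpha_map X cP @` O).
Proof.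
move=> oO.
pose U := [set z | polyhedral_set P F z ->
  exists2 u, O u & \val (alpha_map X cP u) = z].
exists U; last first.
  apply/seteqP; split=> [z /(_ (set_valP z))[u Ou uz]|_ [u Ou <-]].
    by exists u => //; exact: val_inj.
  by move=> _; exists u.
apply: (kquotient_kprod (q := fun i => qclass (cone_equiv R (X i)))).
- by move=> i; exact: kquotient_qclass.
- by move=> i; exact: qclass_continuous.
move=> K g chK cg.
have cgi i : continuous (fun k => g k i : X i * unit_itv R).
  exact: (comp_continuous (comp_continuous cg
    (@prod_coord_continuous _ (fun i => kprod2 (X i) (unit_itv R)) i))
    (@kify_id_continuous (X i * unit_itv R)%type)).
pose x k i := (g k i).1; pose s k i := (g k i).2.
have cx : continuous (x : K -> prod_topology X).
  apply: prod_topology_continuous => i.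
  exact: (comp_continuous (cgi i) (@continuous_fst _ _)).
have cs : continuous (s : K -> prod_topology (fun=> unit_itv R)).
  apply: prod_topology_continuous => i.
  exact: (comp_continuous (cgi i) (@continuous_snd _ _)).
(* The part of the test space that is sent into the polyhedral product. Being closed, it is again
   compact Hausdorff. *)
pose S := [set k | range c (s k)].
have clS : closed S.
  by have /continuous_closedP := cs; apply; exact: cubical_range_closed.
have /choice[p cp] (k : S) : exists p, c p = s (\val k).
  by have [p _ cp] := set_valP k; exists p.
have cval : continuous (\val : S -> K) by exact: initial_continuous.
(* Since [c] is an embedding, continuity of [p] follows from that of [c \o p], which is [s]
   restricted to [S]. *)
have p_continuous : continuous p.
  apply/continuousP => V /(cub_embedding cP).2[V' oV' ->].
  have /continuousP/(_ _ oV') := comp_continuous cval cs.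
  by congr open; apply/funext => k; rewrite /preimage /= cp.
pose f (k : S) : kprod2 (X_all X) P := (x (\val k), p k).
have chS := compact_hausdorff_closed chK clS.
have cf : continuous f.
  apply: continuous_to_kify => //; apply: continuous_pair => //.
  by apply: continuous_to_kify => //; exact: (comp_continuous cval cx).
have /continuousP/(_ _ oO)[B oB BE] := comp_continuous cf class1_continuous.
(* Outside [S] membership in [U] is vacuous; on [S] it amounts to [B], an open set of [K] whose
   trace is the preimage of [O]. *)
suff -> : [set k | U (fun i => qclass (cone_equiv R (X i)) (g k i))] =
    ~` S `|` B.
  by apply: openU => //; exact: closed_openC.
have gE k : (fun i => qclass (cone_equiv R (X i)) (g k i)) =
    fun i => cone_pt (x k i) (s k i).
  apply/functional_extensionality_dep => i.
  by rewrite /cone_pt -surjective_pairing.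
have alphaS (k : S) : \val (alpha_map X cP (class1 F (x (\val k)) (p k))) =
    fun i => cone_pt (x (\val k) i) (s (\val k) i).
  by apply/functional_extensionality_dep => i; rewrite alphaE cp.
have BS (k : S) : B (\val k) = O (class1 F (x (\val k)) (p k)).
  by rewrite -[RHS]/(((fun k => class1 F (f k).1 (f k).2) @^-1` O) k) -BE.
have alphak k (Sk : S k) : exists2 v, B k = O v &
    \val (alpha_map X cP v) = fun i => cone_pt (x k i) (s k i).
  pose k' : S := exist _ k (mem_set Sk).
  by exists (class1 F (x k) (p k')); [exact: (BS k')|exact: (alphaS k')].
apply/seteqP; split=> k; rewrite /setU /setC /= gE.
  have [/alphak[v Bv av]|] := pselect (S k); last by left.
  rewrite -av => Uk; right; rewrite Bv.
  (* Injectivity of [alpha_map] identifies the point of [O] supplied by [U] with [v]. *)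
  by have [u Ou /val_inj/alpha_inj <-] := Uk (set_valP _).
move=> SB zk; have Sk := polyhedral_set_range zk.
have [v Bv av] := alphak k Sk; exists v => //.
by case: SB => //; rewrite Bv.
Qed.

Lemma alpha_homeomorphism : homeomorphism (alpha_map X cP).
Proof.
by apply: homeomorphism_of_open; [exact: alpha_inj|exact: alpha_surj|
  exact: alpha_continuous|exact: alpha_open].
Qed.

(** * The map [gamma] and the commuting square *)

Lemma gamma_homeomorphism : homeomorphism (gamma_map lam a cP).
Proof.
apply: homeomorphism_comp h_map_homeomorphism _.
apply: orbit_homeomorphism alpha_homeomorphism.
- by move=> t u; exact: alpha_equivariant.
- by move=> u; exact: alpha_barE.
Qed.

End DiagramHomeomorphisms.

Theorem theorem4p1 (R : realType) (n m : nat)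
    (P : set 'rV[R]_n) (F : 'I_m -> set 'rV[R]_n)
    (lam : 'M[int]_(n, m))
    (X : 'I_m -> topologicalType) (a : forall i, circle_action R (X i))
    (c : P -> prod_topology (fun _ : 'I_m => unit_itv R))
    (hP : simple_polytope P F)
    (hlam : characteristic_function P F lam)
    (ha : forall i, free_action (a i))
    (hc : cubical_structure F c) :
  [/\ forall u : space1 P F X,
        gamma_map lam a hc (beta_map lam a u) =
        delta_map lam a (alpha_map X hc u),
      homeomorphism (alpha_map X hc) &
      homeomorphism (gamma_map lam a hc)].
Proof.
split; [move=> u|exact: alpha_homeomorphism|exact: gamma_homeomorphism].
(* In [gamma_map] after [beta_map], [h_map] cancels [h_inv], leaving [alpha_bar] on the orbit of
   [u]. *)
by rewrite /gamma_map /beta_map /= h_invK alpha_barE.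
Qed.
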